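(* Let $\mathbf w=(w_n)_{n\in\mathbb Z}$ be a sequence of positive real numbers which is bounded and bounded below (i.e. $\inf_n w_n>0$), and let $B_{\mathbf w}$ be the bilateral weighted shift on $c_0(\mathbb Z)$ defined by $B_{\mathbf w}(e_n)=w_ne_{n-1}$, $n\in\mathbb Z$. Then $B_{\mathbf w}$ is frequently hypercyclic (resp. $\mathcal U$-frequently hypercyclic) on $c_0(\mathbb Z)$ if and only if there exist a sequence $(M(p))_{p\ge1}$ of positive real numbers tending to $+\infty$ and a sequence $(E_p)_{p\ge 1}$ of subsets of $\mathbb Z_+$ such that (a) for any $p\geq 1$, $\underline d(E_p)>0$ (resp. $\bar d(E_p)>0$); (b) for any $p,q\geq 1$ with $p\neq q$, $(E_p+[-p,p])\cap (E_q+[-q,q])=\emptyset$; (c) for any $p\ge 1$, $\lim_{n\to+\infty,\ n\in E_p}w_1\cdots w_n=+\infty$; (d) for any $p,q\geq 1$, any $n\in E_p$ and any $m\in E_q$ with $n\neq m$, $$w_1\cdots w_{m-n}\geq M(p)M(q)\ \text{ if } m>n,\qquad w_{m-n+1}\cdots w_0\leq \frac1{M(p)M(q)}\ \text{ if } m<n.$$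
   Context: $(e_n)_{n\in\mathbb Z}$ is the standard basis of $c_0(\mathbb Z)$ (families indexed by $\mathbb Z$ tending to $0$ at $\pm\infty$, sup norm). Intervals such as $[-p,p]$ are intervals of integers. For $A\subset\mathbb Z_+=\{0,1,2,\dots\}$ let $A(n)=\{a\in A: a\le n\}$, $\underline d(A)=\liminf_{n\to+\infty}\frac{\#A(n)}{n}$ (lower density) and $\bar d(A)=\limsup_{n\to+\infty}\frac{\#A(n)}{n}$ (upper density). A bounded operator $T$ on a Banach space $X$ is frequently hypercyclic (resp. $\mathcal U$-frequently hypercyclic) if there is a vector $x\in X$ such that for every nonempty open $U\subset X$ the set $\{n\in\mathbb Z_+: T^nx\in U\}$ has positive lower density (resp. positive upper density). *)

(* Defs.v *)
From HB Require Import structures.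
From mathcomp Require Import all_boot all_order all_algebra.
From mathcomp Require Import all_classical all_reals all_analysis.
From mathcomp Require Export complex.
From mathcomp Require Import zify.

Set Implicit Arguments.
Unset Strict Implicit.
Unset Printing Implicit Defensive.
Import Order.TTheory GRing.Theory Num.Theory.
Import numFieldNormedType.Exports.
Local Open Scope classical_set_scope.
Local Open Scope ring_scope.

Section c0_space.
Variable K : numFieldType.

Definition c0_pred : {pred int -> K} := fun x =>
  `[< (fun k : nat => x k%:Z) @ \oo --> (0 : K) /\
      (fun k : nat => x (- k%:Z)) @ \oo --> (0 : K) >].

Lemma c0_predP (x : int -> K) : x \in c0_pred <->
  forall e : K, 0 < e -> exists N : nat,
    forall n : int, (N <= `|n|)%N -> `|x n| < e.
Proof.
split=> [/asboolP[/cvgr0Pnorm_lt xp /cvgr0Pnorm_lt xm] e e0|H].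
  have [N1 _ h1] := xp _ e0; have [N2 _ h2] := xm _ e0.
  exists (maxn N1 N2) => n; rewrite geq_max => /andP[n1 n2].
  have [nN|nN] := lerP 0 n.
    by have := h1 `|n|%N n1; rewrite /= gez0_abs.
  by have := h2 `|n|%N n2; rewrite /= ltz0_abs// opprK.
apply/asboolP; split; apply/cvgr0Pnorm_lt => e e0; have [N HN] := H e e0;
  by exists N => // k /= Nk; apply: HN; rewrite ?abszN.
Qed.

Lemma c0_pred_submod : submod_closed c0_pred.
Proof.
split=> [|a x y /c0_predP xc /c0_predP yc]; apply/c0_predP => e e0.
  by exists 0%N => n _; rewrite normr0.
have e2 : 0 < e / 2 by rewrite divr_gt0.
have a1 : 0 < `|a| + 1 by rewrite ltr_wpDl.
have [N1 h1] := xc _ (divr_gt0 e2 a1); have [N2 h2] := yc _ e2.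
exists (maxn N1 N2) => n; rewrite geq_max => /andP[/h1 n1 /h2 n2].
rewrite (le_lt_trans (ler_normD _ _))// [e]splitr ler_ltD//= normrM.
rewrite (@le_trans _ _ ((`|a| + 1) * `|x n|))//.
  by rewrite ler_wpM2r// lerDl.
by rewrite mulrC -ler_pdivlMr// ltW.
Qed.

HB.instance Definition _ :=
  GRing.isSubmodClosed.Build K (int -> K) c0_pred c0_pred_submod.

Record c0 := C0 { c0_val :> int -> K; _ : c0_val \in c0_pred }.

HB.instance Definition _ := [isSub for c0_val].
HB.instance Definition _ := [Choice of c0 by <:].
HB.instance Definition _ := [SubChoice_isSubLmodule of c0 by <:].

(* Stated in the (partial) order of [K], where the elements [`|x n|] are
   pairwise comparable, so that it applies to complex scalars as well. *)
Definition c0_norm (x : c0) : K := supremum 0 (range (fun n => `|x n|)).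

Lemma c0_attained (x : c0) : exists m, forall n, `|x n| <= `|x m|.
Proof.
have [x0|/existsNP[n0 /eqP xn0]] := pselect (forall n, x n = 0).
  by exists 0 => n; rewrite !x0.
have /c0_predP/(_ `|x n0|) := valP x; rewrite normr_gt0 => /(_ xn0)[N HN].
have fin k : exists m, forall n : int, (`|n| <= k)%N -> `|x n| <= `|x m|.
  elim: k => [|k [m IH]].
    by exists 0 => n; rewrite leqn0 absz_eq0 => /eqP ->.
  have maxex (u v : int) : exists m, `|x u| <= `|x m| /\ `|x v| <= `|x m|.
    have := real_leVge (normr_real (x u)) (normr_real (x v)).
    by case/orP=> h; [exists v|exists u].
  have [m1 [mm1 k1]] := maxex m k.+1%:Z.
  have [m2 [m12 k2]] := maxex m1 (- k.+1%:Z).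
  exists m2 => n; rewrite leq_eqVlt => /orP[/eqP nk|nk].
    have [n0'|n0'] := lerP 0 n.
      by rewrite -(gez0_abs n0') nk (le_trans k1).
    by rewrite -[n]opprK -(ltz0_abs n0') nk.
  by rewrite (le_trans (IH n nk))// (le_trans mm1).
have [m Hm] := fin (maxn N `|n0|).
exists m => n; have [nN|/ltnW nN] := leqP `|n| N.
  by apply: Hm; rewrite leq_max nN.
by rewrite (le_trans (ltW (HN _ nN)))// Hm// leq_maxr.
Qed.

Lemma c0_normP (x : c0) : exists2 m, c0_norm x = `|x m| &
  forall n, `|x n| <= c0_norm x.
Proof.
have [m Hm] := c0_attained x.
suff e : c0_norm x = `|x m| by exists m => // n; rewrite e.
have sm : supremums (range (fun n => `|x n|)) `|x m|.
  by split=> [_ [n _ <-]|y]; [exact: Hm|apply; exists m].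
rewrite /c0_norm /supremum ifF; last by apply/eqP/eqP/set0P; exists `|x m|, m.
by case: xgetP => [y _ ys|/(_ _ sm)//]; exact: is_subset1_supremums ys sm.
Qed.

Lemma ler_c0_normD (x y : c0) : c0_norm (x + y) <= c0_norm x + c0_norm y.
Proof.
have [m -> _] := c0_normP (x + y).
have [_ _ hx] := c0_normP x; have [_ _ hy] := c0_normP y.
by rewrite (le_trans (ler_normD _ _))// lerD.
Qed.

Lemma c0_normZ (l : K) (x : c0) : c0_norm (l *: x) = `|l| * c0_norm x.
Proof.
have [m hm h1] := c0_normP (l *: x); have [k hk h2] := c0_normP x.
apply/eqP; rewrite eq_le; apply/andP; split.
  by rewrite hm normrM ler_wpM2l.
by rewrite hk -normrM; exact: h1.
Qed.

Lemma c0_norm0_eq0 (x : c0) : c0_norm x = 0 -> x = 0.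
Proof.
have [_ _ h] := c0_normP x => x0; apply/val_inj/funext => n /=.
by apply/eqP; rewrite -normr_le0 -x0 h.
Qed.

HB.instance Definition _ :=
  Lmodule_isNormed.Build K c0 ler_c0_normD c0_normZ c0_norm0_eq0.

Lemma c0_basis_subproof (n : int) : (fun k => (k == n)%:R : K) \in c0_pred.
Proof.
apply/c0_predP => e e0; exists `|n|.+1 => k nk.
by rewrite (_ : (k == n) = false) ?normr0//; apply: contraTF nk => /eqP->;
  rewrite ltnn.
Qed.

Definition c0_basis (n : int) : c0 := C0 (c0_basis_subproof n).

Lemma bshift_subproof (w : int -> K) (x : c0) :
  (exists C, forall n, `|w n| <= C) ->
  (fun n : int => w (n + 1) * x (n + 1)) \in c0_pred.
Proof.
move=> [C wC]; apply/c0_predP => e e0.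
have C0' : 0 <= C by rewrite (le_trans _ (wC 0)).
have C1 : 0 < C + 1 by rewrite ltr_wpDl.
have /c0_predP/(_ _ (divr_gt0 e0 C1))[N HN] := valP x.
exists N.+1 => n Nn; rewrite normrM.
have /HN xn : (N <= `|(n + 1)%R|)%N by lia.
rewrite (@le_lt_trans _ _ ((C + 1) * `|x (n + 1)|))//.
  by rewrite ler_wpM2r// (le_trans (wC _))// lerDl.
by rewrite mulrC -ltr_pdivlMr.
Qed.

Lemma weighted_shift_exists (w : int -> K) :
  (exists C, forall n, `|w n| <= C) ->
  exists T : {linear c0 -> c0}, [/\ continuous T,
    forall n, T (c0_basis n) = w n *: c0_basis (n - 1) &
    forall x n, T x n = w (n + 1) * x (n + 1)].
Proof.
move=> wC; pose f (x : c0) : c0 := C0 (bshift_subproof x wC).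
have flin : linear f.
  move=> a x y; apply/val_inj/funext => n /=.
  by rewrite /GRing.scale/= !fctE/= mulrDr /GRing.scale/= mulrCA.
pose ml := GRing.isLinear.Build K c0 c0 *:%R f flin.
pose T : {linear c0 -> c0} := HB.pack f ml.
exists T; split=> //.
- have [C wC'] := wC.
  have Creal : C \is Num.real by rewrite ger0_real// (le_trans _ (wC' 0)).
  apply/bounded_linear_continuous/linear_boundedP; near=> r => x.
  have [_ _ hx] := c0_normP x; have [m hm _] := c0_normP (T x).
  rewrite [`|T x|]hm -[T x m]/(w (m + 1) * x (m + 1)) normrM ler_pM//.
  by rewrite (le_trans (wC' _))//; near: r; exact: nbhs_pinfty_ge.
- move=> n; apply/val_inj/funext => k /=.
  rewrite -[RHS]/(w n * (k == n - 1)%:R) [k == _]eq_sym subr_eq eq_sym.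
  by have [->//|] := eqVneq (k + 1) n; rewrite !mulr0.
Unshelve. all: by end_near. Qed.

End c0_space.

Definition count_upto (A : set nat) (n : nat) : nat :=
  #|[pred a : 'I_n.+1 | (a : nat) \in A]|.

(* The value at [n = 0] is [_ / 0 = 0], which a lim inf or sup ignores. *)
Definition lower_density (R : realType) (A : set nat) : \bar R :=
  limn_einf (fun n => ((count_upto A n)%:R / n%:R)%:E).

Definition upper_density (R : realType) (A : set nat) : \bar R :=
  limn_esup (fun n => ((count_upto A n)%:R / n%:R)%:E).

(* [R] only serves as the value field of the density. *)
Definition frequently_hypercyclic (R : realType) (X : topologicalType)
    (T : X -> X) : Prop :=
  exists x : X, forall U : set X, open U -> U !=set0 ->
    (0 < lower_density R [set n | U (iter n T x)])%E.

Definition U_frequently_hypercyclic (R : realType) (X : topologicalType)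
    (T : X -> X) : Prop :=
  exists x : X, forall U : set X, open U -> U !=set0 ->
    (0 < upper_density R [set n | U (iter n T x)])%E.

Definition thicken (p : nat) (E : set nat) : set int :=
  [set n%:Z + k | n in E & k in [set k : int | - p%:Z <= k <= p%:Z]].

(* The families are indexed by [p >= 1]: the values [M 0] and [E 0] are
   irrelevant.  In the last clause, the product [w_(m-n+1) ... w_0] is written
   with the indices [- i], [0 <= i < n - m]. *)
Definition shift_criterion (R : realType) (density : set nat -> \bar R)
    (w : int -> R) : Prop :=
  exists (M : nat -> R) (E : nat -> set nat),
  [/\ (forall p, (1 <= p)%N -> 0 < M p) /\ M @ \oo --> +oo,
      forall p, (1 <= p)%N -> (0 < density (E p))%E,
      forall p q, (1 <= p)%N -> (1 <= q)%N -> p <> q ->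
        thicken p (E p) `&` thicken q (E q) = set0,
      forall p, (1 <= p)%N ->
        \prod_(1 <= i < n.+1) w i%:Z @[n --> within (E p) \oo] --> +oo &
      forall p q, (1 <= p)%N -> (1 <= q)%N ->
        forall n m : nat, E p n -> E q m ->
        ((n < m)%N -> M p * M q <= \prod_(1 <= i < (m - n).+1) w i%:Z) /\
        ((m < n)%N -> \prod_(0 <= i < n - m) w (- i%:Z) <= (M p * M q)^-1)].

(* Main.v *)
Require Import Defs.
From HB Require Import structures.
From mathcomp Require Import all_boot all_order all_algebra.
From mathcomp Require Import all_classical all_reals all_analysis.
From mathcomp Require Import complex.
From mathcomp Require Import zify ring lra.
Set Implicit Arguments.
Unset Strict Implicit.
Unset Printing Implicit Defensive.
Import Order.TTheory GRing.Theory Num.Theory.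
Import numFieldNormedType.Exports.
Local Open Scope classical_set_scope.
Local Open Scope ring_scope.

(* Let W be the prefix product of the weights, W j / W (j - 1) = w j, W 0 = 1.
   Then W l (B^n x)_l = W (l + n) x_(l + n): an iterate and an entry of x share
   the invariant W j x_j, and both inequalities of (d) say W (m - n) >= M p M q.
   Given a suitable x, take for E_p the times n at which B^n x is close to the
   vector with entries a_(p,k) / W k, |k| <= p, where the a_(p,k) are distinct
   large integers: W (n + k) x_(n + k) then determines (p, k), which separates
   the E_p, and the smallness of B^n x away from [-p, p] gives (d).
   Conversely, copy the vectors y_p of a dense sequence of finitely supported
   vectors into x near each n in E_(phi p), as x_(n + k) = W k y_p(k) / W (n + k),
   along a subsequence phi with M (phi p) huge compared with y_p; by (d) the
   copies do not overlap and B^n x is within 1 / M (phi p) of y_p. *)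

(** * Monotonicity of the two densities *)

Section density.
Variable R : realType.

Let ratio (A : set nat) n : \bar R := ((count_upto A n)%:R / n%:R)%:E.

Lemma count_upto_subset (A B : set nat) n :
  A `<=` B -> (count_upto A n <= count_upto B n)%N.
Proof.
move=> AB; apply/subset_leq_card/fintype.subsetP => a.
by rewrite !inE => /AB.
Qed.

Let ratio_subset (A B : set nat) n : A `<=` B -> (ratio A n <= ratio B n)%E.
Proof.
by move=> AB; rewrite lee_fin ler_wpM2r ?invr_ge0// ler_nat count_upto_subset.
Qed.

Lemma upper_density_subset (A B : set nat) :
  A `<=` B -> (upper_density R A <= upper_density R B)%E.
Proof.
move=> AB; rewrite /upper_density !limn_esup_lim.
apply: lee_lim; [exact: is_cvg_esups|exact: is_cvg_esups|].
apply: nearW => n; apply: ge_ereal_sup => _ [k nk <-].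
apply: (le_trans (ratio_subset k AB)).
by apply: ereal_sup_ubound; exists k.
Qed.

Lemma lower_density_subset (A B : set nat) :
  A `<=` B -> (lower_density R A <= lower_density R B)%E.
Proof.
move=> AB; rewrite /lower_density !limn_einf_lim.
apply: lee_lim; [exact: is_cvg_einfs|exact: is_cvg_einfs|].
apply: nearW => n; apply: le_ereal_inf_tmp => _ [k nk <-].
apply: le_trans (ratio_subset k AB).
by apply: ereal_inf_lbound; exists k.
Qed.

Let ratio_set0 : ratio set0 @ \oo --> 0%E.
Proof.
rewrite (_ : ratio set0 = cst 0%E); first exact: cvg_cst.
apply/funext => n; rewrite /ratio /count_upto eq_card0 ?mul0r// => i.
by rewrite !inE in_set0.
Qed.

(** With its lower counterpart, this shows that a set of positive density has an element. *)
Lemma upper_density_set0 : upper_density R set0 = 0%E.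
Proof. by have [] := cvg_limn_einf_sup ratio_set0. Qed.

Lemma lower_density_set0 : lower_density R set0 = 0%E.
Proof. by have [] := cvg_limn_einf_sup ratio_set0. Qed.

End density.

(** * Coordinates in $c_0(\mathbb Z)$ and in the image of a weighted shift *)

Section c0_facts.
Variable K : numFieldType.
Implicit Types x : c0 K.

Lemma c0_coord_le x n : `|x n| <= `|x|.
Proof. by have [_ _ h] := c0_normP x; exact: h. Qed.

(** The supremum is attained, so the strict inequality survives. *)
Lemma c0_norm_lt x (e : K) : (forall n, `|x n| < e) -> `|x| < e.
Proof. by have [m hm _] := c0_normP x => h; rewrite [`|x|]hm. Qed.

Lemma c0_ballP x y (e : K) : ball x e y <-> forall n, `|x n - y n| < e.
Proof.
rewrite -ball_normE /=; split=> [h n|h].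
  exact: le_lt_trans (c0_coord_le (x - y) n) h.
by apply: c0_norm_lt.
Qed.

(** [B] agrees with the coordinatewise shift [T] on finitely supported vectors. Truncating [x]
    leaves a small tail [x - u], on which [B - T] takes the same value as on [x]; continuity at [0]
    makes that value [0]. *)
Lemma bshift_coord (v : int -> K) (B : {linear c0 K -> c0 K}) :
  (exists C, forall n, `|v n| <= C) -> continuous B ->
  (forall n, B (c0_basis K n) = v n *: c0_basis K (n - 1)) ->
  forall x n, B x n = v (n + 1) * x (n + 1).
Proof.
move=> vC Bc Be; have [T [Tc Te Tn]] := weighted_shift_exists vC.
suff BT x : B x = T x by move=> x n; rewrite BT Tn.
have trunc (s : seq int) : exists u : c0 K, B u = T u /\
    forall n, u n = if n \in s then x n else 0.
  elim: s => [|a s [u [Bu us]]]; first by exists 0; rewrite !linear0.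
  have [as_|as_] := boolP (a \in s).
    exists u; split=> // n; rewrite us in_cons.
    by case: eqVneq => [->|//]; rewrite as_.
  exists (u + x a *: c0_basis K a); split.
    by rewrite !linearD !linearZ /= Bu Be Te.
  move=> n; rewrite -[LHS]/(u n + x a * (n == a)%:R) us in_cons.
  by case: eqVneq => [->|_]; rewrite ?(negbTE as_) ?mulr1 ?add0r ?mulr0 ?addr0.
have Dc : (B z - T z) @[z --> (0 : c0 K)] --> B 0 - T 0.
  exact: cvgB (Bc 0) (Tc 0).
apply/eqP; rewrite -subr_eq0; apply/negbNE/negP; rewrite -normr_gt0.
move=> e0; have /cvgrPdist_lt/(_ _ e0)/nbhs_ballP[d /= d0 dD] := Dc.
have /c0_predP/(_ _ d0)[N HN] := valP x.
(* The list enumerates [[-N, N]]. *)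
have [u [Bu us]] := trunc [seq i%:Z - N%:Z | i <- iota 0 (N.*2.+1)].
have /dD : ball 0 d (x - u).
  apply/c0_ballP => n; rewrite sub0r normrN -[(x - u) n]/(x n - u n) us.
  case: ifPn => ns; first by rewrite subrr normr0.
  rewrite subr0; apply: HN; rewrite leqNgt; apply: contra ns => nN.
  apply/mapP; exists (absz (n + N%:Z)); first by rewrite mem_iota; lia.
  by lia.
by rewrite /= (linear0 B) (linear0 T) subrr sub0r normrN (linearB B) (linearB T)
  /= Bu opprB addrA subrK ltxx.
Qed.

End c0_facts.

(** * Two-sided products of the weights and their growth *)

Section weight_product.
Variables (R : realType) (w : int -> R).
Hypothesis w_gt0 : forall n, 0 < w n.

(* [weight_prod (- n)] is the inverse of [w_0 w_(-1) ... w_(-n+1)]. *)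
Definition weight_prod (j : int) : R :=
  match j with
  | Posz n => \prod_(1 <= i < n.+1) w i%:Z
  | Negz n => (\prod_(0 <= i < n.+1) w (- i%:Z))^-1
  end.
Local Notation W := weight_prod.

Lemma weight_prod_gt0 j : 0 < W j.
Proof. by case: j => n /=; rewrite ?invr_gt0 prodr_gt0. Qed.

Lemma weight_prod0 : W 0 = 1.
Proof. by rewrite /= big_geq. Qed.

Lemma weight_prodS j : W (j + 1) = w (j + 1) * W j.
Proof.
have w0 n : w n != 0 by rewrite gt_eqF.
case: j => [n|[|n]].
- by rewrite -PoszD addn1 /= big_nat_recr//= mulrC.
- by rewrite /= big_geq// big_nat1 oppr0 divff.
- rewrite (_ : Negz n.+1 + 1 = Negz n); last lia.
  rewrite /= [in RHS]big_nat_recr//= (_ : Negz n = - n.+1%:Z)//.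
  by rewrite invfM mulrCA divff ?mulr1.
Qed.

Variable kappa : R.
Hypotheses (kappa_gt0 : 0 < kappa) (w_le : forall n, w n <= kappa)
  (w_ge : forall n, kappa^-1 <= w n).

(** Each unit step, in either direction, multiplies [W] by some [w i] or its inverse, hence by at
    most [kappa]. *)
Lemma weight_prodD_le j k : W (j + k) <= kappa ^+ `|k|%N * W j.
Proof.
have up n : W (j + n%:Z) <= kappa ^+ n * W j.
  elim: n => [|n IH]; first by rewrite addr0 expr0 mul1r.
  rewrite -addn1 PoszD addrA weight_prodS addn1 exprS -mulrA ler_pM// ltW//.
  exact: weight_prod_gt0.
have down n : W (j - n%:Z) <= kappa ^+ n * W j.
  elim: n => [|n IH]; first by rewrite subr0 expr0 mul1r.
  rewrite exprS -mulrA (le_trans _ (ler_wpM2l (ltW kappa_gt0) IH))//.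
  rewrite (_ : j - n%:Z = j - n.+1%:Z + 1); last lia.
  rewrite weight_prodS mulrA ler_peMl ?(ltW (weight_prod_gt0 _))//.
  by rewrite -(mulfV (lt0r_neq0 kappa_gt0)) ler_wpM2l// ltW.
by case: k => n; [exact: up|rewrite NegzE; exact: down].
Qed.

Lemma weight_prod_le k : W k <= kappa ^+ `|k|%N.
Proof.
by rewrite -[k in W k]add0r (le_trans (weight_prodD_le _ _))// weight_prod0 mulr1.
Qed.

End weight_product.

Section criterion.
Variables (R : realType) (w : int -> R).
Hypothesis w_gt0 : forall n, 0 < w n.
Local Notation W := (weight_prod w).

(** At a negative argument [W] is the inverse of the product in (d), so taking inverses turns the
    second inequality into the form of the first. *)
Lemma weight_prod_subE (n m : nat) (A : R) : 0 < A ->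
  ((n < m)%N -> A <= \prod_(1 <= i < (m - n).+1) w i%:Z) /\
  ((m < n)%N -> \prod_(0 <= i < n - m) w (- i%:Z) <= A^-1) <->
  (n != m -> A <= W (m%:Z - n%:Z)).
Proof.
move=> A0; have [nm|mn|->] := ltngtP n m; last by [].
  rewrite subzn ?(ltnW nm)//=; split=> [[h _] _|h]; first exact: h.
  by split=> // _; exact: h.
rewrite (_ : m%:Z - n%:Z = Negz (n - m).-1); last by rewrite NegzE; lia.
rewrite /= prednK ?subn_gt0//.
have p0 : 0 < \prod_(0 <= i < n - m) w (- i%:Z) by rewrite prodr_gt0.
split=> [[_ /(_ isT)] h _|/(_ isT) h]; first by rewrite -lef_pV2 ?invrK ?posrE ?invr_gt0.
by split=> // _; rewrite -lef_pV2 ?invrK ?posrE ?invr_gt0.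
Qed.

End criterion.

Arguments weight_prod : simpl never.

(** * A dense sequence of finitely supported vectors, and subsequences along which [M] is large *)

Section countable_density.
Variables (R : realType) (K : numFieldType) (emb : {rmorphism R -> K}).
Variables (Q : countType) (q : Q -> K).
Hypothesis q_dense : forall (z : K) (e : R), 0 < e ->
  exists a, `|z - q a| < emb e.
Hypothesis emb_gt0 : forall r, (0 < emb r) = (0 < r).

(** The index [p] encodes a support radius, a list of coordinates and a free number [r p]. Each
    vector thus recurs with [r p] as large as desired, which later prescribes how accurately it is
    copied. *)
Lemma finite_support_dense : exists (N r : nat -> nat) (y : nat -> c0 K),
  (forall p k, (N p < `|k|)%N -> y p k = 0) /\
  forall (z : c0 K) (e : R), 0 < e ->
    exists p, (forall k, `|z k - y p k| < emb e) /\ (r p).+1%:R^-1 < e.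
Proof.
have [a0 _] := q_dense 0 (@ltr01 R).
pose data p : nat * seq Q * nat := odflt (0%N, [::], 0%N) (unpickle p).
pose y p k := let: (N, s, _) := data p in
  if (`|k| <= N)%N then q (nth a0 s (absz (k + N%:Z))) else 0.
have y_supp p k : ((data p).1.1 < `|k|)%N -> y p k = 0.
  by rewrite /y; case: (data p) => -[N s r] /=; rewrite ltnNge => /negbTE ->.
have yc p : y p \in @c0_pred K.
  apply/c0_predP => e e0; exists (data p).1.1.+1 => n pn.
  by rewrite y_supp ?normr0.
exists (fun p => (data p).1.1), (fun p => (data p).2), (fun p => C0 (yc p)).
split=> [//|z e e0].
have ee0 : 0 < emb e by rewrite emb_gt0.
have /c0_predP/(_ _ ee0)[N HN] := valP z.
have [g gz] := choice (fun k => q_dense (z k) e0).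
(* Position [i] of the list holds the coordinate [i - N], so that [[-N, N]] takes [2 N + 1]
   entries. *)
pose s := mkseq (fun i => g (i%:Z - N%:Z)) N.*2.+1.
exists (pickle (N, s, Num.truncn e^-1)); rewrite /= /y /data pickleK /=; split.
  move=> k; case: leqP => kN; last by rewrite subr0 HN// ltnW.
  rewrite nth_mkseq; last lia.
  by rewrite (_ : (absz (k + N%:Z))%:Z - N%:Z = k); [exact: gz|lia].
by rewrite invf_plt ?posrE// truncnS_gt.
Qed.

End countable_density.

(** [P p] is a rank beyond which [M] exceeds [A p]; summing these ranks makes [phi] increasing, and
    the shift by 2 keeps the index 1 out of its range. *)
Lemma fast_subsequence (R : realType) (M A : nat -> R) : M @ \oo --> +oo ->
  exists phi : nat -> nat, injective phi /\
    forall p, (1 < phi p)%N /\ A p < M (phi p).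
Proof.
move=> /cvgryPgt Moo.
have /choice[P PM] : forall p, exists P : nat, forall n, (P <= n)%N -> A p < M n.
  by move=> p; have [P _ HP] := Moo (A p); exists P.
pose phi p := (p + 2 + \sum_(i < p.+1) P i)%N.
have phiS p : (phi p < phi p.+1)%N by rewrite /phi [in ltnRHS]big_ord_recr /=; lia.
have phi_lt : {homo phi : i j / (i < j)%N}.
  by apply: homo_ltn => //; exact: ltn_trans.
exists phi; split=> [i j e|p].
  by have [/phi_lt|/phi_lt|//] := ltngtP i j; rewrite e ltnn.
split; first by rewrite /phi; lia.
by apply: PM; rewrite /phi big_ord_recr /=; lia.
Qed.

Section embedded_weights.
(* [emb] stands for the identity of [R] or the embedding of [R] into [R[i]]. *)
Variables (R : realType) (K : numFieldType) (emb : {rmorphism R -> K}).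
Hypothesis emb_le : {mono emb : x y / x <= y}.
Hypothesis emb_onto : forall e : K, 0 <= e -> exists r, emb r = e.

Let emb_lt : {mono emb : x y / x < y}.
Proof. exact: leW_mono. Qed.

Let emb_gt0 r : (0 < emb r) = (0 < r).
Proof. by rewrite -(rmorph0 emb) emb_lt. Qed.

Let emb_ge0 r : (0 <= emb r) = (0 <= r).
Proof. by rewrite -(rmorph0 emb) emb_le. Qed.

Let emb_norm r : 0 < r -> `|emb r| = emb r.
Proof. by move=> r0; rewrite gtr0_norm// emb_gt0. Qed.

Variable w : int -> R.
Hypothesis w_gt0 : forall n, 0 < w n.
Local Notation W := (weight_prod w).

Let W_gt0 := weight_prod_gt0 w_gt0.

Variable kappa : R.
Hypotheses (kappa_ge1 : 1 <= kappa) (w_le : forall n, w n <= kappa)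
  (w_ge : forall n, kappa^-1 <= w n).

Let kappa_gt0 : 0 < kappa.
Proof. exact: lt_le_trans kappa_ge1. Qed.

Let W_le := weight_prod_le w_gt0 kappa_gt0 w_le w_ge.
Let WD_le := weight_prodD_le w_gt0 kappa_gt0 w_le w_ge.

Variable B : c0 K -> c0 K.
Hypothesis B_coord : forall x n, B x n = emb (w (n + 1)) * x (n + 1).

(** The weight produced by one step of [B] turns [W l] into [W (l + 1)]. *)
Lemma iter_bshift_coord n x l :
  emb (W l) * iter n B x l = emb (W (l + n%:Z)) * x (l + n%:Z).
Proof.
elim: n l => [|n IH] l; first by rewrite !addr0.
rewrite iterS B_coord mulrA -rmorphM mulrC/= [W l * _]mulrC -weight_prodS//.
by rewrite mulrC IH -addrA -PoszD.
Qed.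

(** * From a vector with large hitting sets to the criterion *)

Section necessity.

(** Consecutive centres [4 (p + 1)^2] are [8 p + 12] apart, more than the sum [2 p + 1] of the radii
    of their windows, so the windows are disjoint. *)
Definition target (p : nat) (k : int) : int := 4 * (p%:Z + 1) ^+ 2 + k.

Lemma target_inj p q (k l : int) : (`|k| <= p)%N -> (`|l| <= q)%N ->
  target p k = target q l -> p = q /\ k = l.
Proof.
rewrite /target => kp lq e.
have [pq|qp|pq] := ltngtP p q.
(* Factored, the distance of the centres is visibly larger than [p + q], which bounds [|k - l|]. *)
- have : 4 * (q%:Z + 1) ^+ 2 - 4 * (p%:Z + 1) ^+ 2 =
    4 * (q%:Z - p%:Z) * (q%:Z + p%:Z + 2) by ring.
  nia.
- have : 4 * (q%:Z + 1) ^+ 2 - 4 * (p%:Z + 1) ^+ 2 =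
    4 * (q%:Z - p%:Z) * (q%:Z + p%:Z + 2) by ring.
  nia.
- by split=> //; move: e; rewrite pq => /addrI.
Qed.

Lemma target_ge p : p%:Z + 2 <= target p 0.
Proof. by rewrite /target addr0; nia. Qed.

Lemma target_c0_subproof p : (fun k : int =>
  if (`|k| <= p)%N then emb ((target p k)%:~R / W k) else 0) \in @c0_pred K.
Proof.
apply/c0_predP => e e0; exists p.+1 => n pn.
by rewrite ifF ?normr0// leqNgt pn.
Qed.

Definition target_vec p : c0 K := C0 (target_c0_subproof p).

(** Multiplied by [W k <= kappa ^+ p] for [|k| <= p], this radius is at most 1/3, enough to tell
    integers apart; the factor [p + 1] serves the coordinates outside [[-p, p]]. *)
Definition target_radius (p : nat) : R := (3 * p.+1%:R * kappa ^+ p)^-1.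

Let radius_gt0 p : 0 < target_radius p.
Proof. by rewrite invr_gt0 !mulr_gt0// exprn_gt0. Qed.

Variable x : c0 K.

Definition hits (p : nat) : set nat :=
  [set n | ball (target_vec p) (emb (target_radius p)) (iter n B x)].

Let v (j : int) : K := emb (W j) * x j.

Let hits_near p n k : hits p n -> (`|k| <= p)%N ->
  `|v (k + n%:Z) - (target p k)%:~R| < emb 3^-1.
Proof.
move=> /c0_ballP/(_ k)/=; rewrite distrC => h kp; rewrite kp in h.
rewrite /v -iter_bshift_coord.
have -> : (target p k)%:~R = emb (W k) * emb ((target p k)%:~R / W k).
  by rewrite -rmorphM/= mulrC divfK ?gt_eqF// rmorph_int.
rewrite -mulrBr normrM emb_norm//.
have Wk0 : 0 < emb (W k) by rewrite emb_gt0.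
apply: (lt_le_trans (_ : _ < emb (W k) * emb (target_radius p))).
  by rewrite ltr_pM2l.
rewrite -rmorphM/= emb_le /target_radius.
have Wk : W k <= kappa ^+ p by rewrite (le_trans (W_le _))// ler_weXn2l.
rewrite ler_pdivrMr ?mulr_gt0 ?exprn_gt0//.
rewrite [leRHS](_ : _ = p.+1%:R * kappa ^+ p); last by field.
rewrite (le_trans Wk)// ler_peMl ?exprn_ge0 ?(ltW kappa_gt0)//.
by rewrite ler1n.
Qed.

(** The target vanishes at [k], so the entry of the iterate is below the radius, itself at most
    [1 / (p + 1)]. *)
Let hits_far p n k : hits p n -> (p < `|k|)%N ->
  `|v (k + n%:Z)| < emb (W k / p.+1%:R).
Proof.
move=> /c0_ballP/(_ k)/=; rewrite leqNgt => h kp; rewrite kp sub0r normrN in h.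
rewrite /v -iter_bshift_coord normrM emb_norm// rmorphM.
rewrite ltr_pM2l ?emb_gt0// (lt_le_trans h)// emb_le.
rewrite lef_pV2 ?posrE ?mulr_gt0 ?exprn_gt0//.
have kp1 : 1 <= kappa ^+ p by rewrite exprn_ege1.
rewrite [leLHS](_ : _ = 1 * p.+1%:R * 1); last by rewrite mul1r mulr1.
by rewrite ler_pM ?ler_pM ?mul1r ?ler1n.
Qed.

(** One value of [v] lies within 1/3 of two integers, which must then coincide. *)
Let hits_inj p q n m (k l : int) : hits p n -> hits q m ->
  (`|k| <= p)%N -> (`|l| <= q)%N -> k + n%:Z = l + m%:Z -> p = q /\ k = l.
Proof.
move=> hn hm kp lq e; apply: target_inj => //.
have := hits_near hm lq; have := hits_near hn kp; rewrite e => h1 h2.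
have : `|(target p k - target q l)%:~R : K| < 1.
  rewrite intrB (le_lt_trans (ler_distD (v (l + m%:Z)) _ _))//.
  rewrite distrC (lt_le_trans (ltrD h1 h2))// -rmorphD -(rmorph1 emb) emb_le.
  by lra.
rewrite -intr_norm -[1]/(1%:~R) ltr_int; lia.
Qed.

(** The central target is at least [p + 2], and the error is below 1. *)
Let hits_big p n : hits p n -> p.+1%:R <= `|v n%:Z|.
Proof.
move=> /(@hits_near p n 0)/(_ (leq0n p)); rewrite add0r => h.
have t1 : p.+1%:R + 1 <= `|(target p 0)%:~R : K|.
  have := target_ge p; rewrite -(ler_int K) => t.
  rewrite (le_trans _ (real_ler_norm _)) ?realz//.
  by apply: le_trans t; rewrite rmorphD /= -pmulrn -addn1 natrD -addrA.
have h1 : `|v n%:Z - (target p 0)%:~R| < 1.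
  by rewrite (lt_le_trans h)// -(rmorph1 emb) emb_le; lra.
have := ler_normB (v n%:Z) (v n%:Z - (target p 0)%:~R).
rewrite subKr => t2.
rewrite -(lerD2r 1) (le_trans t1)// (le_trans t2)// lerD2l ltW//.
Qed.

Lemma hits_disjoint p q : p <> q ->
  thicken p (hits p) `&` thicken q (hits q) = set0.
Proof.
move=> pq; rewrite -subset0 => _ [[n hn [k /= kp <-]] [m hm [l /= lq e]]].
by have [|||/pq//] := @hits_inj p q n m k l hn hm; lia.
Qed.

(** [W n |x n|] stays at least 1 while [x n] tends to [0]. *)
Lemma hits_cvg p :
  \prod_(1 <= i < n.+1) w i%:Z @[n --> within (hits p) \oo] --> +oo.
Proof.
apply/cvgryPge => A; pose A1 := Num.max A 1.
have A10 : 0 < A1 by rewrite lt_max ltr01 orbT.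
have A0 : 0 < emb A1^-1 by rewrite emb_gt0 invr_gt0.
have /c0_predP/(_ _ A0)[N HN] := valP x.
exists N => // n /= Nn hn; apply: (@le_trans _ _ A1); first by rewrite le_max lexx.
rewrite -[leRHS]/(W n%:Z) -emb_le.
have : 1 <= emb (W n%:Z) * emb A1^-1.
  apply: (@le_trans _ _ p.+1%:R); first by rewrite ler1n.
  rewrite (le_trans (hits_big hn))// /v normrM emb_norm//.
  by rewrite ler_wpM2l ?emb_ge0 ?(ltW (W_gt0 _))// ltW// HN.
by rewrite fmorphV ler_pdivlMr ?emb_gt0// mul1r.
Qed.

(** If [|m - n| <= p], both hits see the position [m], and [hits_inj] forces [n = m]. Otherwise
    [v m] has size at least [q + 1] by the hit at [m] and less than [W (m - n) / (p + 1)] by the hit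
    at [n]. *)
Lemma hits_weight p q n m : hits p n -> hits q m -> n != m ->
  p%:R * q%:R <= W (m%:Z - n%:Z).
Proof.
move=> hn hm nm.
have [kp|kp] := leqP `|m%:Z - n%:Z| p.
  have [||//|_] := @hits_inj p q n m (m%:Z - n%:Z) 0 hn hm; lia.
have := hits_far hn kp; rewrite subrK => h.
have := le_lt_trans (hits_big hm) h.
rewrite -(rmorph_nat emb) emb_lt ltr_pdivlMr// => /ltW; apply: le_trans.
by rewrite mulrC ler_pM// ler_nat.
Qed.

Lemma shift_criterion_necessary (density : set nat -> \bar R) :
  (forall U : set (c0 K), open U -> U !=set0 ->
    (0 < density [set n | U (iter n B x)])%E) ->
  shift_criterion density w.
Proof.
move=> hx; exists (fun p => p%:R), hits; split.
- by split=> [p p0|]; [rewrite ltr0n|exact: cvgr_idn].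
- move=> p _; apply: hx; first exact: ball_open.
  by exists (target_vec p); apply: ballxx; rewrite emb_gt0.
- by move=> p q _ _; exact: hits_disjoint.
- by move=> p _; exact: hits_cvg.
- move=> p q p0 q0 n m hn hm; apply/weight_prod_subE.
  + exact: w_gt0.
  + by rewrite mulr_gt0 ?ltr0n.
  + exact: hits_weight.
Qed.

End necessity.

(** * Gluing copies of the vectors [y p] into a single vector *)

Section blocks.
Variables (S : nat -> set nat) (m b : nat -> R) (N : nat -> nat).
Variables (y : nat -> int -> K) (g0 : R).
Hypothesis S_disjoint : forall p q n, S p n -> S q n -> p = q.
Hypothesis S_separated : forall p q n n', S p n -> S q n' -> n != n' ->
  m p * m q <= W (n'%:Z - n%:Z).
Hypothesis S_growth : forall p n, S p n -> g0 * m p <= W n%:Z.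
Hypothesis S_cvg : forall p A, exists J : nat,
  forall n, S p n -> (J <= n)%N -> A <= W n%:Z.
Hypothesis y_supp : forall p k, (N p < `|k|)%N -> y p k = 0.
Hypothesis y_le : forall p k, `|y p k| <= emb (b p).
Hypothesis b_ge0 : forall p, 0 <= b p.
(** [m_sep] keeps the copies apart, [m_dom] bounds the effect of a copy at the times of the others,
    and [m_small] with [S_growth] makes the copies of [y p] uniformly small as [p] grows. *)
Hypothesis m_sep : forall p, kappa ^+ N p < m p.
Hypothesis m_dom : forall p, kappa ^+ N p * kappa ^+ N p * b p <= m p.
Hypothesis m_small : forall p,
  kappa ^+ N p * kappa ^+ N p * b p * p.+1%:R <= g0 * m p.

Let kX_gt0 n : 0 < kappa ^+ n.
Proof. exact: exprn_gt0. Qed.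

Let kX_le k n : (k <= n)%N -> kappa ^+ k <= kappa ^+ n.
Proof. by move=> kn; rewrite ler_weXn2l. Qed.

Let m_gt0 p : 0 < m p.
Proof. exact: lt_trans (m_sep p). Qed.

(* An overlap would give [m p * m q <= W (k - l) <= kappa ^+ (N p + N q)]. *)
Let blocks_inj p q n n' (k l : int) : S p n -> S q n' ->
  (`|k| <= N p)%N -> (`|l| <= N q)%N -> k + n%:Z = l + n'%:Z -> n = n'.
Proof.
move=> Sn Sn' kN lN e; apply/eqP/negP => /negP nn'.
have := S_separated Sn Sn' nn'; apply/negP; rewrite -ltNge.
rewrite (_ : n'%:Z - n%:Z = k - l); last lia.
apply: (@le_lt_trans _ _ (kappa ^+ N p * kappa ^+ N q)).
  by rewrite (le_trans (W_le _))// -exprD kX_le//; lia.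
by rewrite ltr_pM// ?m_sep// ltW.
Qed.

Let dec (j : int) p n := S p n /\ (`|(j - n%:Z)%R| <= N p)%N.

Let dec_inj j p n q n' : dec j p n -> dec j q n' -> p = q /\ n = n'.
Proof.
move=> [Sn jn] [Sn' jn'].
have nn' : n = n' by apply: (blocks_inj Sn Sn' jn jn'); rewrite !subrK.
by split=> //; apply: S_disjoint Sn _; rewrite nn'.
Qed.

(** A position belongs to at most one copy, so the prescription is consistent; the factor
    [W (j - n) / W j] is what [n] iterations of [B] cancel. *)
Let glue_ex : exists x : int -> K, forall j,
  (forall p n, dec j p n -> x j = emb (W (j - n%:Z) / W j) * y p (j - n%:Z)) /\
  ((forall p n, ~ dec j p n) -> x j = 0).
Proof.
suff /choice[x xP] : forall j, exists v : K,
    (forall p n, dec j p n -> v = emb (W (j - n%:Z) / W j) * y p (j - n%:Z)) /\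
    ((forall p n, ~ dec j p n) -> v = 0) by exists x.
move=> j; have [[p [n d]]|nd] := pselect (exists p n, dec j p n).
  exists (emb (W (j - n%:Z) / W j) * y p (j - n%:Z)); split=> [q n' d'|/(_ p n)//].
  by have [-> ->] := dec_inj d d'.
by exists 0; split=> // p n d; case: nd; exists p, n.
Qed.

(** Both [j - n] and the displacement from [j] to [n] have size at most [N p], so [W (j - n)] and
    [W n / W j] are each at most [kappa ^+ N p]. *)
Let dec_bound j p n : dec j p n ->
  `|emb (W (j - n%:Z) / W j) * y p (j - n%:Z)| <=
  emb (kappa ^+ N p * kappa ^+ N p * b p / W n%:Z).
Proof.
move=> [Sn jn]; rewrite normrM emb_norm ?divr_gt0//.
apply: (@le_trans _ _ (emb (W (j - n%:Z) / W j) * emb (b p))).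
  by rewrite ler_wpM2l// emb_ge0 ltW// divr_gt0.
rewrite -rmorphM/= emb_le [leRHS]mulrAC ler_wpM2r//.
rewrite -mulrA; apply: ler_pM; rewrite ?invr_ge0 ?(ltW (W_gt0 _))//.
  by rewrite (le_trans (W_le _))// kX_le.
rewrite ler_pdivlMr// mulrC ler_pdivrMr//.
have := WD_le j (n%:Z - j); rewrite subrKC => h.
by rewrite (le_trans h)// ler_wpM2r ?(ltW (W_gt0 _))// kX_le//; lia.
Qed.

(** On [[-N p, N p]] the iterate equals [y p]. Elsewhere it shows either [0] or an entry of another
    copy, which the separation of the times makes small. *)
Lemma blocks_vector : exists x : c0 K, forall p n, S p n ->
  forall l, `|iter n B x l - y p l| <= emb (m p)^-1.
Proof.
have [x xP] := glue_ex.
(* For finitely many [p], the entries tend to [0] because [W] tends to infinity along each [S p]. *)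
have tail P (e : R) : 0 < e -> exists J : nat, forall p n j, (p < P)%N ->
    dec j p n -> (J <= `|j|)%N -> `|x j| < emb e.
  move=> e0; elim: P => [|P [J1 H1]]; first by exists 0%N.
  (* The added 1 makes the final bound strict; adding [N P] to [J2] below passes from [j] to the
     centre [n]. *)
  have [J2 H2] := S_cvg P ((kappa ^+ N P * kappa ^+ N P * b P + 1) / e).
  exists (maxn J1 (J2 + N P)) => p n j; rewrite ltnS leq_eqVlt geq_max.
  move=> /orP[/eqP->|pP] d /andP[j1 j2]; last exact: H1 pP d j1.
  have [/(_ _ _ d)-> _] := xP j; rewrite (le_lt_trans (dec_bound d))// emb_lt.
  have [Sn jn] := d; rewrite ltr_pdivrMr//.
  have /(H2 _ Sn) : (J2 <= n)%N by lia.
  rewrite ler_pdivrMr// [W _ * e]mulrC => h.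
  by apply: lt_le_trans h; rewrite ltrDl.
have xc : x \in @c0_pred K.
  apply/c0_predP => _ /[dup] /ltW/emb_onto[e <-]; rewrite emb_gt0 => e0.
  have [J HJ] := tail (Num.truncn e^-1) _ e0.
  exists J => j Jj; have [xd x0] := xP j.
  have [[p [n d]]|nd] := pselect (exists p n, dec j p n); last first.
    by rewrite x0 ?normr0 ?emb_gt0// => p n d; apply: nd; exists p, n.
  (* Beyond this threshold [1 / (p + 1) < e], and [m_small] bounds the entries of all remaining
     copies at once. *)
  have [pe|pe] := ltnP p (Num.truncn e^-1); first exact: HJ pe d Jj.
  rewrite (xd _ _ d) (le_lt_trans (dec_bound d))// emb_lt.
  have [Sn _] := d; apply: (@le_lt_trans _ _ p.+1%:R^-1).
    rewrite ler_pdivrMr// [leRHS]mulrC ler_pdivlMr//.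
    exact: le_trans (m_small p) (S_growth Sn).
  rewrite invf_plt ?posrE// (lt_le_trans (truncnS_gt _))// ler_nat ltnS//.
exists (C0 xc) => p n Sn l.
have -> : iter n B (C0 xc) l = emb (W (l + n%:Z) / W l) * x (l + n%:Z).
  apply: (mulfI (_ : emb (W l) != 0)); first by rewrite gt_eqF// emb_gt0.
  by rewrite iter_bshift_coord mulrA -rmorphM/= mulrCA divff ?mulr1// gt_eqF.
have [xd x0] := xP (l + n%:Z).
have [lN|Nl] := leqP `|l| (N p).
  rewrite (xd p n); last by split=> //; rewrite addrK.
  rewrite addrK mulrA -rmorphM/= mulrA divfK ?gt_eqF// divff ?gt_eqF//.
  by rewrite rmorph1 mul1r subrr normr0 emb_ge0 invr_ge0 ltW.
rewrite (y_supp Nl) subr0.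
have [[q [n' d]]|nd] := pselect (exists q n', dec (l + n%:Z) q n'); last first.
  rewrite x0 ?mulr0 ?normr0 ?emb_ge0 ?invr_ge0 ?ltW//.
  by move=> q n' d; apply: nd; exists q, n'.
rewrite (xd _ _ d); case: d => Sn' jn.
set k := l + n%:Z - n'%:Z in jn *.
have nn' : n != n'.
  apply/eqP => nn'; move: jn Nl; rewrite /k -nn' addrK.
  rewrite -nn' in Sn'; rewrite (S_disjoint Sn Sn'); lia.
rewrite mulrA -rmorphM/= (_ : _ * (_ / _) = W k / W l); last first.
  by field; rewrite !gt_eqF.
rewrite normrM emb_norm ?divr_gt0//.
apply: (@le_trans _ _ (emb (W k / W l) * emb (b q))).
  by rewrite ler_wpM2l// emb_ge0 ltW// divr_gt0.
rewrite -rmorphM/= emb_le.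
(* Since [n' - n = l - k] with [|k| <= N q], the separation of [n] and [n'] is a lower bound for
   [W l]. *)
have Wl : m p * m q <= kappa ^+ N q * W l.
  rewrite (le_trans (S_separated Sn Sn' nn'))//.
  rewrite (_ : n'%:Z - n%:Z = l + - k); last by rewrite /k; lia.
  by rewrite (le_trans (WD_le _ _))// ler_wpM2r ?(ltW (W_gt0 _))// kX_le// abszN.
rewrite mulrAC ler_pdivrMr// [leRHS]mulrC ler_pdivlMr//.
rewrite -(ler_pM2r (kX_gt0 (N q))).
rewrite [leRHS]mulrC (le_trans _ Wl)// [leLHS](_ : _ =
  m p * (W k * kappa ^+ N q * b q)); last by ring.
rewrite ler_wpM2l ?(ltW (m_gt0 _))//.
rewrite (le_trans _ (m_dom q))// !ler_wpM2r ?(ltW (kX_gt0 _))//.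
by rewrite (le_trans (W_le _))// kX_le.
Qed.

End blocks.

(** * From the criterion to a vector with large hitting sets *)

Variables (Q : countType) (q : Q -> K).
Hypothesis q_dense : forall (z : K) (e : R), 0 < e ->
  exists a, `|z - q a| < emb e.

Variable density : set nat -> \bar R.
Hypothesis density_subset : forall A A', A `<=` A' ->
  (density A <= density A')%E.
Hypothesis density_set0 : density set0 = 0%E.

Lemma shift_criterion_sufficient : shift_criterion density w ->
  exists x, forall U : set (c0 K), open U -> U !=set0 ->
    (0 < density [set n | U (iter n B x)])%E.
Proof.
move=> [M [E [[M0 Moo] dE Edisj Ecvg Esep]]].
have [N [r [y [y_supp y_dense]]]] := finite_support_dense q_dense emb_gt0.
have /choice[b bE] : forall p, exists b, emb b = `|y p|.
  by move=> p; exact: emb_onto.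
have b0 p : 0 <= b p by rewrite -emb_ge0 bE.
have E_inj p p' n : (1 <= p)%N -> (1 <= p')%N -> E p n -> E p' n -> p = p'.
  move=> p1 p1' Epn Epn'; apply: contrapT => pp'.
  suff : (thicken p (E p) `&` thicken p' (E p')) n%:Z by rewrite Edisj.
  by split; exists n => //; exists 0; rewrite /= ?addr0//; lia.
(* Comparison with this point makes [W] at least [g0 * M p] on all of [E p],
   [p > 1], so that [x] tends to [0] without removing points from [E p]. *)
have [n0 En0] : E 1 !=set0.
  by apply/set0P/eqP => E0; have := dE 1 isT; rewrite E0 density_set0 ltxx.
have kX_gt0 n : 0 < kappa ^+ n by rewrite exprn_gt0.
pose g0 := M 1 / kappa ^+ n0; have g00 : 0 < g0 by rewrite divr_gt0// M0.
pose C p := kappa ^+ N p * kappa ^+ N p * b p.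
have C0 p : 0 <= C p by rewrite !mulr_ge0// ltW.
have [phi [phi_inj phiP]] := fast_subsequence
  (* All summands are nonnegative, so [M (phi p)] exceeds each: the first three meet the size
     conditions of [blocks_vector], the last gives the accuracy. *)
  (fun p => kappa ^+ N p + C p + C p * p.+1%:R / g0 + (r p).+1%:R) Moo.
have phi1 p : (1 <= phi p)%N by have [/ltnW] := phiP p.
have D0 p : 0 <= C p * p.+1%:R / g0 by rewrite (divr_ge0 _ (ltW g00))// mulr_ge0.
have big p : [/\ kappa ^+ N p < M (phi p), C p <= M (phi p),
    C p * p.+1%:R / g0 <= M (phi p) & (r p).+1%:R < M (phi p)].
  have [_] := phiP p; have := D0 p; have := C0 p; have := kX_gt0 (N p).
  by have := ler0n R (r p).+1; split; lra.
have sep p p' n n' : (1 <= p)%N -> (1 <= p')%N -> E p n -> E p' n' ->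
    n != n' -> M p * M p' <= W (n'%:Z - n%:Z).
  move=> p1 p1' En En'; apply/weight_prod_subE => //.
    by rewrite mulr_gt0// M0.
  exact: Esep.
have [x xP] : exists x : c0 K, forall p n, E (phi p) n ->
    forall l, `|iter n B x l - y p l| <= emb (M (phi p))^-1.
  apply: (@blocks_vector (E \o phi) (M \o phi) b N (fun p => y p) g0) => //.
  - by move=> p p' n En En'; apply: phi_inj; apply: E_inj En En'.
  - by move=> p p' n n'; exact: sep.
  (* As [phi] avoids the index 1, [n0] lies in no [E (phi p)] and can be compared with every [n]
     there. *)
  - move=> p n En; have n0n : n0 != n.
      apply/eqP => n0n; have [+ _] := phiP p.
      by rewrite -(_ : 1%N = phi p)//; apply: E_inj En0 _; rewrite ?n0n.
    rewrite /g0 mulrAC ler_pdivrMr// (le_trans (sep _ _ _ _ _ _ En0 En n0n))//.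
    by rewrite mulrC (le_trans (WD_le _ _))// abszN.
  - move=> p A; have /cvgryPge/(_ A)[J _ HJ] := Ecvg _ (phi1 p).
    by exists J => n En Jn; exact: HJ.
  - by move=> p k; rewrite bE c0_coord_le.
  - by move=> p; have [] := big p.
  - by move=> p; have [] := big p.
  - by move=> p; have [_ _ + _] := big p; rewrite ler_pdivrMr// [M _ * _]mulrC.
exists x => U oU [z Uz].
have /nbhs_ballP[_ /[dup] /ltW/emb_onto[e <-] + eU] := open_nbhs_nbhs (conj oU Uz).
rewrite /= emb_gt0 => e0; have e2 : 0 < e / 2 by rewrite divr_gt0.
have [p [zy re]] := y_dense z _ e2.
(* Every [n] in [E (phi p)] is a hit: [y p] is within [e / 2] of [z], and the iterate is within
   [1 / M (phi p) < 1 / (r p + 1) < e / 2] of [y p]. *)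
apply: lt_le_trans (dE _ (phi1 p)) (density_subset _) => n En /=.
apply/eU/c0_ballP => l; rewrite [e]splitr rmorphD.
apply: le_lt_trans (ler_distD (y p l) _ _) _; rewrite ltrD// distrC.
apply: le_lt_trans (xP _ _ En _) _; rewrite emb_lt; apply: lt_trans re.
by have [_ _ _ rM] := big p; rewrite ltf_pV2 ?posrE// (lt_trans _ rM).
Qed.

Lemma hypercyclic_iff :
  (exists x, forall U : set (c0 K), open U -> U !=set0 ->
    (0 < density [set n | U (iter n B x)])%E) <-> shift_criterion density w.
Proof.
split=> [[x hx]|]; last exact: shift_criterion_sufficient.
exact: shift_criterion_necessary hx.
Qed.

End embedded_weights.

(** * Both densities, and both real and complex scalars *)

Lemma frequently_hypercyclic_iff (R : realType) (K : numFieldType)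
    (emb : {rmorphism R -> K}) (Q : countType) (q : Q -> K) (w : int -> R)
    (B : {linear c0 K -> c0 K}) :
  {mono emb : x y / x <= y} ->
  (forall e : K, 0 <= e -> exists r, emb r = e) ->
  (forall (z : K) (e : R), 0 < e -> exists a, `|z - q a| < emb e) ->
  (forall n, 0 < w n) ->
  (exists C, forall n, w n <= C) ->
  (exists2 c, 0 < c & forall n, c <= w n) ->
  continuous B ->
  (forall n, B (c0_basis K n) = emb (w n) *: c0_basis K (n - 1)) ->
  (frequently_hypercyclic R B <-> shift_criterion (@lower_density R) w) /\
  (U_frequently_hypercyclic R B <-> shift_criterion (@upper_density R) w).
Proof.
move=> emb_le emb_onto q_dense w_gt0 [C wC] [c c0 wc] Bc Be.
have C0 : 0 < C := lt_le_trans (w_gt0 0) (wC 0).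
have ci0 : 0 < c^-1 by rewrite invr_gt0.
have B_coord : forall x n, B x n = emb (w (n + 1)) * x (n + 1).
  apply: (bshift_coord (v := emb \o w)) => //; exists (emb C) => n /=.
  by rewrite ger0_norm ?emb_le// -(rmorph0 emb) emb_le ltW.
(* This [kappa] dominates [1], the upper bound [C] and the inverse of the lower bound [c]. *)
have k1 : 1 <= 1 + C + c^-1 by lra.
have wk n : w n <= 1 + C + c^-1 by have := wC n; lra.
have kw n : (1 + C + c^-1)^-1 <= w n.
  by rewrite (le_trans _ (wc n))// invf_ple ?posrE//; lra.
(* The density enters only through monotonicity and its value on the empty set. *)
split; apply: (hypercyclic_iff emb_le emb_onto w_gt0 k1 wk kw B_coord q_dense).
- exact: lower_density_subset.
- exact: lower_density_set0.
- exact: upper_density_subset.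
- exact: upper_density_set0.
Qed.

Lemma ratr_dense (R : realType) (z e : R) : 0 < e ->
  exists a : rat, `|z - ratr a| < e.
Proof.
move=> e0; have [|a] := @rat_in_itvoo _ (z - e) (z + e); first by lra.
rewrite in_itv /= => /andP[az za]; exists a.
by rewrite ltr_norml; apply/andP; split; lra.
Qed.

Lemma complex_ratr_dense (R : realType) (z : R[i]) (e : R) : 0 < e ->
  exists a : rat * rat, `|z - (ratr a.1 +i* ratr a.2)%C| < e%:C%C.
Proof.
move=> e0; have e2 : 0 < e / 2 by rewrite divr_gt0.
case: z => x y; have [a xa] := ratr_dense x e2; have [b yb] := ratr_dense y e2.
have normC (r : R) : `|r%:C%C| = (`|r|)%:C%C.
  by rewrite normc_def /= expr0n addr0 sqrtr_sqr.
exists (a, b) => /=.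
(* Splitting into real and imaginary parts reduces the bound to the triangle inequality, with
   [e / 2] for each part. *)
rewrite (_ : _ - _ = (x - ratr a)%:C%C + 'i%C * (y - ratr b)%:C%C); last first.
  by apply/eqP; rewrite eq_complex /=; apply/andP; split; apply/eqP; ring.
rewrite (le_lt_trans (ler_normD _ _))// normrM normCi mul1r !normC.
by rewrite -rmorphD ltcR; lra.
Qed.

Theorem theorem12 (R : realType) (w : int -> R)
    (w_gt0 : forall n, 0 < w n)
    (w_bounded : exists C : R, forall n, w n <= C)
    (w_bounded_below : exists2 c : R, 0 < c & forall n, c <= w n) :
  (forall B : {linear c0 R -> c0 R}, continuous B ->
     (forall n : int, B (c0_basis R n) = w n *: c0_basis R (n - 1)) ->
     (frequently_hypercyclic R B <->
        shift_criterion (@lower_density R) w) /\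
     (U_frequently_hypercyclic R B <->
        shift_criterion (@upper_density R) w)) /\
  (forall B : {linear c0 R[i] -> c0 R[i]}, continuous B ->
     (forall n : int,
        B (c0_basis R[i] n) = (w n)%:C%C *: c0_basis R[i] (n - 1)) ->
     (frequently_hypercyclic R B <->
        shift_criterion (@lower_density R) w) /\
     (U_frequently_hypercyclic R B <->
        shift_criterion (@upper_density R) w)).
Proof.
split=> B Bc Be.
- apply: (@frequently_hypercyclic_iff R R idfun rat ratr) => //.
    by move=> e _; exists e.
  exact: ratr_dense.
- apply: (@frequently_hypercyclic_iff R R[i] (real_complex R)
    (rat * rat)%type (fun a => (ratr a.1 +i* ratr a.2)%C)) => //.
  + by move=> r s; rewrite lecR.
  (* A nonnegative complex number has zero imaginary part. *)
  + by case=> a b; rewrite lecE /= => /andP[/eqP -> _]; exists a.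
  + exact: complex_ratr_dense.
Qed.
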